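(* Let $K,M\ge 1$, let $\mathbf{h}_1,\dots,\mathbf{h}_K\in\mathbb{C}^{1\times M}$ be the rows of $\mathbf{H}\in\mathbb{C}^{K\times M}$, let $\mathbf{d}=(d_1,\dots,d_K)$ with $d_j\in\mathbb{C}$, $|d_j|=1$, let $\mathbf{r}=(r_1,\dots,r_K)$ with $r_j>0$, and let $P>0$. Let $\mathbf{q}(\mathbf{d},\mathbf{H},\mathbf{r})$ denote the optimal solution of the weighted max-min problem $$\max_{\mathbf{q}\in\mathbb{C}^{M\times 1}}\ \min_{1\le j\le K}\ \frac{|\mathbf{h}_j\mathbf{q}|^2}{r_j}\quad\text{s.t.}\quad \|\mathbf{q}\|^2\le P,\quad \angle(\mathbf{h}_j\mathbf{q})=\angle(d_j),\ j=1,\dots,K,$$ assumed feasible, and let $t^*$ be its optimal value. For $\boldsymbol\zeta=(\zeta_1,\dots,\zeta_K)$ with $\zeta_j>0$, let $\mathbf{x}(\mathbf{d},\mathbf{H},\boldsymbol\zeta)$ denote the optimal solution of the power minimization problem $$\min_{\mathbf{x}\in\mathbb{C}^{M\times 1}}\ \|\mathbf{x}\|^2\quad\text{s.t.}\quad \angle(\mathbf{h}_j\mathbf{x})=\angle(d_j),\quad |\mathbf{h}_j\mathbf{x}|^2\ge\zeta_j,\qquad j=1,\dots,K.$$ Then $$\mathbf{q}(\mathbf{d},\mathbf{H},\mathbf{r})=\mathbf{x}(\mathbf{d},\mathbf{H},t^*\mathbf{r}).$$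
   Context: $\|\cdot\|$ is the Euclidean norm. For a nonzero complex number $z$, $\angle z$ denotes its argument (angle modulo $2\pi$); a constraint $\angle(z)=\angle(d)$ requires $z\neq 0$. The $d_j$ are unit-modulus (M-PSK) data symbols, $\mathbf{h}_j$ is the channel of user $j$, $r_j$ is the weight (requested SNR) of user $j$, and $P$ is the transmit power budget. The noise variance is $1$. *)

(* Defs.v *)
From HB Require Import structures.
From mathcomp Require Import all_boot all_order all_algebra.
From mathcomp Require Import complex.
From mathcomp Require Import boolp classical_sets reals trigo.

Set Implicit Arguments.
Unset Strict Implicit.
Unset Printing Implicit Defensive.

Import Order.TTheory GRing.Theory Num.Theory.

Local Open Scope classical_set_scope.
Local Open Scope ring_scope.

Section Precoding.
Variable R : realType.

(* [normc] is the real-valued modulus; [`|z|] is the same number seen in R[i]. *)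
Definition cmod (z : R[i]) : R := Normc.normc z.

(* The argument modulo 2 pi is the set of all its real determinations, a coset
   of 2 pi Z when z != 0.  For z = 0 this set is all of R, so constraints on
   angles must exclude 0 separately. *)
Definition angle (z : R[i]) : set R :=
  [set t | z = (cmod z)%:C%C * Complex (cos t) (sin t)].

Definition enorm (n : nat) (v : 'cV[R[i]]_n) : R :=
  Num.sqrt (\sum_(i < n) cmod (v i 0) ^+ 2).

(* There are K.+1 users and M.+1 antennas, so both numbers are at least 1. *)
Variables K M : nat.
Implicit Types (H : 'M[R[i]]_(K.+1, M.+1)) (d : 'I_K.+1 -> R[i]).
Implicit Types (r zeta : 'I_K.+1 -> R) (P : R) (q x : 'cV[R[i]]_M.+1).

Definition received H q (j : 'I_K.+1) : R[i] := (row j H *m q) 0 0.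

Definition aligned H d q : Prop :=
  forall j, received H q j != 0 /\ angle (received H q j) = angle (d j).

(* The default value of the iterated minimum is one of its terms, so it is the
   minimum over the nonempty set of users. *)
Definition maxmin_objective H r q : R :=
  let gain j := cmod (received H q j) ^+ 2 / r j in
  \big[Num.min/gain ord0]_(j < K.+1) gain j.

Definition maxmin_feasible H d P : set 'cV[R[i]]_M.+1 :=
  [set q | enorm q ^+ 2 <= P /\ aligned H d q].

Definition maxmin_optima H d r P : set 'cV[R[i]]_M.+1 :=
  [set q | maxmin_feasible H d P q /\
     forall q', maxmin_feasible H d P q' ->
       maxmin_objective H r q' <= maxmin_objective H r q].

Definition maxmin_value H d r P : R :=
  sup [set maxmin_objective H r q | q in maxmin_feasible H d P].

Definition powermin_feasible H d zeta : set 'cV[R[i]]_M.+1 :=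
  [set x | aligned H d x /\
     forall j, zeta j <= cmod (received H x j) ^+ 2].

Definition powermin_optima H d zeta : set 'cV[R[i]]_M.+1 :=
  [set x | powermin_feasible H d zeta x /\
     forall x', powermin_feasible H d zeta x' ->
       enorm x ^+ 2 <= enorm x' ^+ 2].

(* "The" optimal solutions, chosen by [xget]; the default 0 is only returned
   when there is no optimum. *)
Definition maxmin_sol d H r P : 'cV[R[i]]_M.+1 :=
  xget 0 (maxmin_optima H d r P).

Definition powermin_sol d H zeta : 'cV[R[i]]_M.+1 :=
  xget 0 (powermin_optima H d zeta).

End Precoding.

(* Main.v *)
(* The angle constraint on user j says that the phase-corrected symbol
   received_j / d_j is a positive real, so the aligned vectors form a convex cone
   on which the gains are squares of linear functions.  If two max-min optima
   differed, their midpoint would reach the same objective with strictly less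
   power (parallelogram law), and scaling it up to power P would do better; a
   maximum exists by compactness.  A vector that meets the targets t* r_j with
   power at most that of the max-min optimum q is itself max-min optimal, hence
   equal to q, and less power is impossible by the same scaling. *)
Require Import Defs.
From HB Require Import structures.
From mathcomp Require Import all_boot all_order all_algebra.
From mathcomp Require Import ring lra.
From mathcomp Require Import complex.
From mathcomp Require Import boolp classical_sets functions reals trigo.
From mathcomp Require Import topology normedtype derive.

Set Implicit Arguments.
Unset Strict Implicit.
Unset Printing Implicit Defensive.

Import Order.TTheory GRing.Theory Num.Theory.
Import numFieldNormedType.Exports.

Local Open Scope classical_set_scope.
Local Open Scope ring_scope.

(** * Modulus and argument of complex numbers *)

Section ComplexModulus.
Variable R : realType.
Implicit Types (z w : R[i]) (a : R).

Lemma cmodE z : (cmod z)%:C%C = `|z|.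
Proof. by rewrite normc_def; case: z. Qed.

Lemma cmod2E z : cmod z ^+ 2 = complex.Re z ^+ 2 + complex.Im z ^+ 2.
Proof. by case: z => x y; rewrite sqr_sqrtr // addr_ge0 ?sqr_ge0. Qed.

Lemma cmod_ge0 z : 0 <= cmod z.
Proof. by case: z => x y; exact: sqrtr_ge0. Qed.

Lemma cmod_eq0 z : (cmod z == 0) = (z == 0).
Proof. by rewrite -(inj_eq (@complexI R)) cmodE rmorph0 normr_eq0. Qed.

Lemma cmodM z w : cmod (z * w) = cmod z * cmod w.
Proof. exact: Normc.normcM. Qed.

Lemma cmod_real a : 0 <= a -> cmod a%:C%C = a.
Proof.
by move=> a_ge0; apply: complexI; rewrite cmodE ger0_norm // ler0c.
Qed.

Lemma cmod_parallelogram z w :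
  cmod (z + w) ^+ 2 + cmod (z - w) ^+ 2 = 2 * (cmod z ^+ 2 + cmod w ^+ 2).
Proof. by case: z w => [a b] [c e]; rewrite !cmod2E /=; ring. Qed.

Lemma unit_polar w : cmod w = 1 ->
  exists t, w = Complex (cos t) (sin t).
Proof.
case: w => x y w1; have := cmod2E (Complex x y); rewrite w1 /= expr1n => xy1.
have x_itv : -1 <= x <= 1.
  rewrite -ler_norml -(@ler_pXn2r _ 2) ?nnegrE // expr1n.
  by rewrite real_normK ?num_real // xy1 lerDl sqr_ge0.
have sin_acosx : sin (acos x) = `|y|.
  by rewrite sin_acos // xy1 [_ + y ^+ 2]addrC addrK sqrtr_sqr.
have cos_acosx : cos (acos x) = x by apply: acosK; rewrite in_itv.
(* [acos] takes its values in $[0, \pi]$, where the sine is nonnegative, so the sign of [y] decides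
   between [acos x] and its opposite. *)
have [y_ge0|/ltW y_le0] := leP 0 y.
  by exists (acos x); rewrite cos_acosx sin_acosx ger0_norm.
by exists (- acos x); rewrite cosN sinN cos_acosx sin_acosx ler0_norm // opprK.
Qed.

(** By [unit_polar] the angle set of [w] is inhabited, and one determination shared with [z] already
    fixes the direction of [z]. Conversely, the nonzero modulus of [z] cancels from the equation
    that defines its angle set. *)
Lemma eq_angle_unitP z w : z != 0 -> cmod w = 1 ->
  angle z = angle w <-> z = (cmod z)%:C%C * w.
Proof.
move=> z0 w1; split => [zw|zE].
  have [t wE] := unit_polar w1.
  have : angle w t by rewrite /angle /= w1 rmorph1 mul1r.
  by rewrite -zw /angle /= {1}wE.
have z0' : (cmod z)%:C%C != 0 :> R[i].
  by rewrite fmorph_eq0 cmod_eq0.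
apply/seteqP; split => t; rewrite /angle /= w1 rmorph1 mul1r.
  by move=> /esym; rewrite {2}zE => /(mulfI z0').
by move=> <-.
Qed.

(** The order of [R[i]] makes [0 < z / w] mean a positive real quotient. In this form the angle
    constraint is visibly stable under sums and positive scaling. *)
Lemma angle_unit_gt0P z w : cmod w = 1 ->
  z != 0 /\ angle z = angle w <-> 0 < z / w.
Proof.
move=> w1; have w0 : w != 0 by rewrite -cmod_eq0 w1 oner_neq0.
split=> [[z0 /eq_angle_unitP -> //]|zw_gt0].
  by rewrite mulfK // ltcR lt_neqAle cmod_ge0 eq_sym cmod_eq0 z0.
have z0 : z != 0.
  by apply: contraTneq zw_gt0 => ->; rewrite mul0r ltxx.
split=> //; apply/eq_angle_unitP => //.
have := gtr0_norm zw_gt0; rewrite normf_div -!cmodE w1 rmorph1 divr1.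
by move=> ->; rewrite divfK.
Qed.

Lemma cmod_div_unit z w : cmod w = 1 -> cmod (z / w) = cmod z.
Proof.
move=> w1; have w0 : w != 0 by rewrite -cmod_eq0 w1 oner_neq0.
by rewrite -[in RHS](divfK w0 z) [RHS]cmodM w1 mulr1.
Qed.

Lemma cmod_gt0_real z : 0 < z -> cmod z = complex.Re z.
Proof.
by move=> z_gt0; apply: complexI; rewrite cmodE gtr0_norm // RRe_real ?gtr0_real.
Qed.

End ComplexModulus.

(** * The Euclidean norm and its strict convexity *)

Section EuclideanNorm.
Variables (R : realType) (n : nat).
Implicit Types (u v : 'cV[R[i]]_n) (a : R).

Lemma enorm2E v : enorm v ^+ 2 = \sum_i cmod (v i 0) ^+ 2.
Proof. by rewrite sqr_sqrtr // sumr_ge0 // => i _; exact: sqr_ge0. Qed.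

Lemma enorm2_gt0 v : (0 < enorm v ^+ 2) = (v != 0).
Proof.
rewrite lt_neqAle sqr_ge0 andbT eq_sym enorm2E; congr (~~ _).
rewrite psumr_eq0 => [|i _]; last exact: sqr_ge0.
apply/allP/eqP => [v0|-> i _]; last by rewrite mxE sqrf_eq0 cmod_eq0 eqxx.
apply/matrixP => i j; rewrite ord1 mxE; apply/eqP.
by have := v0 i (mem_index_enum _); rewrite sqrf_eq0 cmod_eq0.
Qed.

Lemma enorm2Z a v : 0 <= a -> enorm (a%:C%C *: v) ^+ 2 = a ^+ 2 * enorm v ^+ 2.
Proof.
move=> a_ge0; rewrite !enorm2E mulr_sumr; apply: eq_bigr => i _.
by rewrite mxE cmodM cmod_real // exprMn.
Qed.

Lemma enorm_parallelogram u v :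
  enorm (u + v) ^+ 2 + enorm (u - v) ^+ 2 =
  2 * (enorm u ^+ 2 + enorm v ^+ 2).
Proof.
rewrite !enorm2E -!big_split mulr_sumr /=; apply: eq_bigr => i _.
by rewrite !mxE cmod_parallelogram.
Qed.

(** By the parallelogram law the squared norm of the midpoint is the mean of the two squared norms
    minus a quarter of $\|u - v\|^2 > 0$. *)
Lemma enorm_midpoint_lt u v (P : R) : u != v ->
  enorm u ^+ 2 <= P -> enorm v ^+ 2 <= P ->
  enorm ((2^-1)%:C%C *: (u + v)) ^+ 2 < P.
Proof.
rewrite -subr_eq0 -enorm2_gt0 enorm2Z ?invr_ge0 // => uv uP vP.
have := enorm_parallelogram u v; lra.
Qed.

End EuclideanNorm.

(** * Scaling, midpoints, uniqueness, and the link between the two problems *)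

Section Precoding.
Variables (R : realType) (K M : nat).
Variables (H : 'M[R[i]]_(K.+1, M.+1)) (d : 'I_K.+1 -> R[i]).
Variables (r : 'I_K.+1 -> R) (P : R).
Hypothesis d_unit : forall j, cmod (d j) = 1.
Hypothesis r_gt0 : forall j, 0 < r j.
Implicit Types (q x : 'cV[R[i]]_M.+1) (t : R).

Lemma receivedD q x j : received H (q + x) j = received H q j + received H x j.
Proof. by rewrite /received mulmxDr mxE. Qed.

Lemma receivedZ (c : R[i]) q j : received H (c *: q) j = c * received H q j.
Proof. by rewrite /received -scalemxAr mxE. Qed.

Lemma alignedP q : aligned H d q <-> forall j, 0 < received H q j / d j.
Proof.
by split=> + j => /(_ j); [rewrite angle_unit_gt0P|rewrite -angle_unit_gt0P].
Qed.

(** This is the bridge between the two problems: the right-hand side is the gain constraint of power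
    minimization with targets [t * r j]. *)
Lemma le_maxmin_objectiveP t q :
  t <= maxmin_objective H r q <->
  forall j, t * r j <= cmod (received H q j) ^+ 2.
Proof.
split=> [/bigmin_geP[_ tq] j|tq].
  by rewrite -ler_pdivlMr ?r_gt0 // tq.
by apply/bigmin_geP; split=> [|j _]; rewrite ler_pdivlMr.
Qed.

Lemma maxmin_objective_gt0 q : aligned H d q -> 0 < maxmin_objective H r q.
Proof.
move=> qal; apply/bigmin_gtP; split=> [|j _];
  rewrite divr_gt0 // exprn_gt0 // lt_neqAle cmod_ge0 eq_sym cmod_eq0;
  by rewrite (qal _).1.
Qed.

Lemma maxmin_improve t q : aligned H d q -> 0 < t ->
  t <= maxmin_objective H r q -> enorm q ^+ 2 < P ->
  exists2 q', maxmin_feasible H d P q' & t < maxmin_objective H r q'.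
Proof.
move=> qal t_gt0 /le_maxmin_objectiveP tq qP.
have q_gt0 : 0 < enorm q ^+ 2.
  rewrite enorm2_gt0; apply/eqP => q0; have [+ _] := qal ord0.
  by rewrite q0 /received mulmx0 mxE eqxx.
pose s := P / enorm q ^+ 2; have s_gt1 : 1 < s by rewrite ltr_pdivlMr ?mul1r.
have s_gt0 : 0 < s by exact: lt_trans s_gt1.
pose a := Num.sqrt s; have a_gt0 : 0 < a by rewrite sqrtr_gt0.
have a2 : a ^+ 2 = s by rewrite sqr_sqrtr // ltW.
exists (a%:C%C *: q).
  split; first by rewrite enorm2Z ?(ltW a_gt0) // a2 divfK ?gt_eqF.
  apply/alignedP => j; rewrite receivedZ -mulrA mulr_gt0 ?ltcR //.
  by move: j; apply/alignedP.
apply: (@lt_le_trans _ _ (s * t)); first by rewrite ltr_pMl.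
apply/le_maxmin_objectiveP => j.
by rewrite receivedZ cmodM cmod_real ?(ltW a_gt0) // exprMn a2 -mulrA ler_pM2l.
Qed.

Lemma midpoint_aligned q x : aligned H d q -> aligned H d x ->
  aligned H d ((2^-1)%:C%C *: (q + x)).
Proof.
move=> /alignedP qal /alignedP xal; apply/alignedP => j.
by rewrite receivedZ receivedD -mulrA mulrDl mulr_gt0 ?addr_gt0 // ltcR invr_gt0.
Qed.

Lemma midpoint_objective t q x : aligned H d q -> aligned H d x -> 0 <= t ->
  t <= maxmin_objective H r q -> t <= maxmin_objective H r x ->
  t <= maxmin_objective H r ((2^-1)%:C%C *: (q + x)).
Proof.
move=> /alignedP qal /alignedP xal t_ge0.
move=> /le_maxmin_objectiveP tq /le_maxmin_objectiveP tx.
apply/le_maxmin_objectiveP => j; move: (tq j) (tx j).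
have mal := addr_gt0 (qal j) (xal j).
rewrite receivedZ receivedD cmodM cmod_real ?invr_ge0 // exprMn.
(* Dividing by the unit symbol [d j] keeps the moduli and makes both received values positive reals,
   so the modulus of their sum is the sum of their real parts. *)
rewrite -(cmod_div_unit (received H q j) (d_unit j)).
rewrite -(cmod_div_unit (received H x j) (d_unit j)).
rewrite -(cmod_div_unit (_ + _) (d_unit j)) mulrDl !cmod_gt0_real // raddfD /=.
have := qal j; have := xal j.
rewrite !ltcE /= => /andP[_]; move: (complex.Re _) => b b_gt0.
move=> /andP[_]; move: (complex.Re _) => a a_gt0.
have tr_ge0 : 0 <= t * r j by rewrite mulr_ge0 // ltW.
move: (t * r j) tr_ge0 => c c_ge0 ca cb.
(* AM-GM: [((a + b) / 2)^2 >= a b], and [a b >= c] since [a^2, b^2 >= c]. *)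
have : c <= a * b.
  rewrite -(@ler_pXn2r _ 2) ?nnegrE ?mulr_ge0 ?(ltW a_gt0) ?(ltW b_gt0) //.
  by rewrite exprMn [leLHS]expr2 ler_pM.
nra.
Qed.

Lemma maxmin_optima_unique q x :
  maxmin_optima H d r P q -> maxmin_optima H d r P x -> q = x.
Proof.
move=> [[qP qal] qmax] [[xP xal] xmax]; apply/eqP/negPn/negP => qx.
have t_gt0 := maxmin_objective_gt0 qal.
have tx : maxmin_objective H r q <= maxmin_objective H r x by exact: xmax.
have := midpoint_objective qal xal (ltW t_gt0) (lexx _) tx.
move=> /(maxmin_improve (midpoint_aligned qal xal) t_gt0).
move=> /(_ (enorm_midpoint_lt qx qP xP))[q' q'feas].
by rewrite ltNge qmax.
Qed.

Lemma maxmin_value_optimum q : maxmin_optima H d r P q ->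
  maxmin_value H d r P = maxmin_objective H r q.
Proof.
move=> [qfeas qmax].
have ub : ubound [set maxmin_objective H r q | q in maxmin_feasible H d P]
    (maxmin_objective H r q) by move=> _ [q' /qmax + <-].
apply/le_anti/andP; split.
  by apply: ge_sup ub; exists (maxmin_objective H r q), q.
by apply: ub_le_sup; [exists (maxmin_objective H r q)|exists q].
Qed.

Lemma powermin_optima_maxmin q : maxmin_optima H d r P q ->
  powermin_optima H d (fun j => maxmin_value H d r P * r j) = [set q].
Proof.
move=> qopt; have [[qP qal] qmax] := qopt.
rewrite (maxmin_value_optimum qopt).
have t_gt0 := maxmin_objective_gt0 qal; set t := maxmin_objective H r q.
have qfeas : powermin_feasible H d (fun j => t * r j) q.
  by split=> //; apply/le_maxmin_objectiveP.
apply/seteqP; split=> [x [[xal xt] xmin]|_ ->]; last first.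
  (* A cheaper vector meeting the targets would leave power to spare, and scaling it up would beat
     the max-min optimum. *)
  split=> // x [xal /le_maxmin_objectiveP tx]; rewrite leNgt; apply/negP => xq.
  have [q' q'feas] := maxmin_improve xal t_gt0 tx (lt_le_trans xq qP).
  by rewrite ltNge qmax.
(* Since [q] competes in the power minimization, [x] respects the budget and is itself max-min
   optimal; uniqueness then applies. *)
have xP : enorm x ^+ 2 <= P by exact: le_trans (xmin q qfeas) qP.
apply: maxmin_optima_unique => //; split=> // q' /qmax q't.
by apply: le_trans q't _; apply/le_maxmin_objectiveP.
Qed.

End Precoding.

(** * Continuity of finite minima, sums and squares *)

Section Continuity.
Variable R : realType.

(** The default [f0] varies with the point because [maxmin_objective] takes the gain of user [ord0]
    as its default. *)
Lemma continuous_bigmin (T : topologicalType) (I : Type) (s : seq I)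
    (f0 : T -> R) (f : I -> T -> R) :
  continuous f0 -> (forall i, continuous (f i)) ->
  continuous (fun x => \big[Num.min/f0 x]_(i <- s) f i x).
Proof.
move=> f0_cont f_cont; elim: s => [|i s IHs] x.
  by under eq_fun do rewrite big_nil; exact: f0_cont.
under eq_fun do rewrite big_cons.
by apply: (@continuous_min R T (f i)); [exact: f_cont|exact: IHs].
Qed.

Lemma continuous_sumr (T : topologicalType) (I : Type) (s : seq I)
    (f : I -> T -> R) :
  (forall i, continuous (f i)) -> continuous (fun x => \sum_(i <- s) f i x).
Proof.
by move=> f_cont; apply: continuous_big => // x; exact: add_continuous.
Qed.

Lemma continuous_sqr (T : topologicalType) (f : T -> R) :
  continuous f -> continuous (fun x => f x ^+ 2).
Proof. by move=> f_cont x; apply: continuousM; exact: f_cont. Qed.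

End Continuity.

(** * Real coordinates on complex vectors, and compactness of the power ball *)

Section RealCoordinates.
Variables (R : realType) (n : nat).

(** Real parts come first, then imaginary parts. Compactness and the extreme value theorem are
    applied to real row vectors and carried over through this map. *)
Definition complex_col (v : 'rV[R]_(n + n)) : 'cV[R[i]]_n :=
  \col_i Complex (v 0 (lshift n i)) (v 0 (rshift n i)).

Lemma complex_col_surj (q : 'cV[R[i]]_n) : exists v, complex_col v = q.
Proof.
exists (row_mx (\row_i complex.Re (q i 0)) (\row_i complex.Im (q i 0))).
apply/matrixP => i j; rewrite ord1 mxE row_mxEl row_mxEr !mxE.
by case: (q i 0).
Qed.

Lemma continuous_Re_complex_col (c : 'I_n -> R[i]) :
  continuous (fun v => complex.Re (\sum_i c i * complex_col v i 0)).
Proof.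
have -> : (fun v => complex.Re (\sum_i c i * complex_col v i 0)) =
    (fun v : 'rV[R]_(n + n) => \sum_i (complex.Re (c i) * v 0 (lshift n i) -
                     complex.Im (c i) * v 0 (rshift n i))).
  apply/funext => v; rewrite raddf_sum; apply: eq_bigr => i _.
  by rewrite mxE; case: (c i).
have coordZ (a : R) k : continuous (fun v : 'rV[R]_(n + n) => a * v 0 k).
  move=> v; apply: (@continuousM R _ (cst a) (fun v : 'rV_(n + n) => v 0 k)).
    exact: cst_continuous.
  exact: coord_continuous.
by apply: continuous_sumr => i v; exact: (continuousB (coordZ _ _ v) (coordZ _ _ v)).
Qed.

(** Reduces to the real part, since $\mathrm{Im}\, z = \mathrm{Re}(-i z)$ and the factor $-i$ can be
    absorbed in the coefficients. *)
Lemma continuous_Im_complex_col (c : 'I_n -> R[i]) :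
  continuous (fun v => complex.Im (\sum_i c i * complex_col v i 0)).
Proof.
have -> : (fun v => complex.Im (\sum_i c i * complex_col v i 0)) =
    (fun v => complex.Re (\sum_i (- 'i%C * c i) * complex_col v i 0)).
  apply/funext => v; under [in RHS]eq_bigr do rewrite -mulrA.
  by rewrite -mulr_sumr; case: (\sum_i _) => a b /=; ring.
exact: continuous_Re_complex_col.
Qed.

Lemma enorm_complex_col v : enorm (complex_col v) ^+ 2 = \sum_i v 0 i ^+ 2.
Proof.
rewrite enorm2E big_split_ord /= -big_split; apply: eq_bigr => i _.
by rewrite mxE cmod2E.
Qed.

End RealCoordinates.

Lemma compact_enorm_le (R : realType) n (P : R) :
  compact [set v : 'rV[R]_(n + n) | enorm (complex_col v) ^+ 2 <= P].
Proof.
apply: bounded_closed_compact; last first.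
  have -> : [set v : 'rV[R]_(n + n) | enorm (complex_col v) ^+ 2 <= P] =
      (fun v : 'rV[R]_(n + n) => \sum_i v 0 i ^+ 2) @^-1` [set y | y <= P].
    by apply/seteqP; split=> v; rewrite /= enorm_complex_col.
  apply: preimage_closed; last exact: closed_le.
  move=> v _; move: v; apply: continuous_sumr => i.
  by apply: continuous_sqr; exact: coord_continuous.
(* Each squared coordinate is at most [P]. The extra 1 ensures [1 < B], so that $P \le B \le B^2$
   bounds each coordinate by [B]. *)
exists (P + 1); split; first exact: num_real.
move=> B PB v /=; rewrite enorm_complex_col => vP.
have P_ge0 : 0 <= P by apply: le_trans vP; apply: sumr_ge0 => i _; exact: sqr_ge0.
have B_gt1 : 1 < B by lra.
rewrite /Num.norm /= mx_normrE; apply/bigmax_leP; split=> [|[i j] _ /=]; first lra.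
rewrite ord1 -(@ler_pXn2r _ 2) ?nnegrE //; last lra.
rewrite real_normK ?num_real //; apply: (@le_trans _ _ P); last by nra.
apply: le_trans vP; rewrite (bigD1 j) //= lerDl.
by apply: sumr_ge0 => k _; exact: sqr_ge0.
Qed.

(** * Existence of a max-min optimum *)

Section Existence.
Variables (R : realType) (K M : nat).
Variables (H : 'M[R[i]]_(K.+1, M.+1)) (d : 'I_K.+1 -> R[i]).
Variables (r : 'I_K.+1 -> R) (P : R).
Hypothesis d_unit : forall j, cmod (d j) = 1.
Hypothesis r_gt0 : forall j, 0 < r j.

Let phase j (v : 'rV[R]_(M.+1 + M.+1)) := received H (complex_col v) j / d j.

Lemma phaseE j v :
  phase j v = \sum_i (H j i / d j) * complex_col v i 0.
Proof.
rewrite /phase /received mxE mulr_suml; apply: eq_bigr => i _.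
by rewrite mxE mulrAC.
Qed.

Lemma continuous_Re_phase j : continuous (fun v => complex.Re (phase j v)).
Proof.
under eq_fun do rewrite phaseE; exact: continuous_Re_complex_col.
Qed.

Lemma continuous_Im_phase j : continuous (fun v => complex.Im (phase j v)).
Proof.
under eq_fun do rewrite phaseE; exact: continuous_Im_complex_col.
Qed.

Lemma continuous_maxmin_objective :
  continuous (fun v => maxmin_objective H r (complex_col v)).
Proof.
have gain_cont j : continuous
    (fun v => cmod (received H (complex_col v) j) ^+ 2 / r j).
  (* The gain is unchanged when the received value is replaced by its phase-corrected version, whose
     real and imaginary parts are continuous. *)
  under eq_fun do rewrite -(cmod_div_unit _ (d_unit j)) cmod2E.
  move=> v; apply: (@continuousM R _
    (fun v => complex.Re (phase j v) ^+ 2 + complex.Im (phase j v) ^+ 2)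
    (cst (r j)^-1)); last exact: cst_continuous.
  have Re2_cont := continuous_sqr (@continuous_Re_phase j).
  have Im2_cont := continuous_sqr (@continuous_Im_phase j).
  exact: continuousD (Re2_cont v) (Im2_cont v).
exact: continuous_bigmin.
Qed.

Lemma maxmin_optima_exists : maxmin_feasible H d P !=set0 ->
  maxmin_optima H d r P !=set0.
Proof.
move=> [q0 [q0P q0al]].
(* The strict constraints [0 < phase j] are not closed, but a maximizer of the
   relaxed problem has a positive objective, hence no vanishing phase. *)
pose S := [set v | enorm (@complex_col R M.+1 v) ^+ 2 <= P] `&`
  \bigcap_(j in [set: 'I_K.+1])
    ([set v | 0 <= complex.Re (phase j v)] `&`
     [set v | complex.Im (phase j v) = 0]).
have feasS v : maxmin_feasible H d P (complex_col v) -> S v.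
  move=> [vP /(alignedP _ d_unit) val]; split=> // j _.
  by have := val j; rewrite ltcE /= => /andP[/eqP Im0 /ltW Re0].
have S_compact : compact S.
  apply: compact_closedI; first exact: compact_enorm_le.
  apply: closed_bigI => j _; apply: closedI.
    by apply: (preimage_closed _ (@closed_ge R 0)) => v _;
      exact: continuous_Re_phase.
  by apply: (preimage_closed _ (@closed_eq R 0)) => v _;
    exact: continuous_Im_phase.
have [v0 v0E] := complex_col_surj q0.
have v0S : S v0 by apply: feasS; rewrite v0E.
have [v] := EVT_max_rV (ex_intro _ v0 v0S) S_compact
  (continuous_subspaceT continuous_maxmin_objective).
rewrite inE => -[vP val] vmax.
(* The relaxed maximizer does at least as well as the given feasible vector, whose gains are all
   positive. *)
have obj_gt0 : 0 < maxmin_objective H r (complex_col v).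
  apply: lt_le_trans (vmax v0 (mem_set v0S)); rewrite v0E.
  exact: (maxmin_objective_gt0 r_gt0 q0al).
exists (complex_col v); split=> [|q qfeas]; last first.
  have [w wE] := complex_col_surj q.
  by rewrite -wE vmax // inE; apply: feasS; rewrite wE.
split=> //; apply/(alignedP _ d_unit) => j; have [Re0 Im0] := val j I.
have : received H (complex_col v) j != 0.
  rewrite -cmod_eq0 -sqrf_eq0 gt_eqF //.
  apply: lt_le_trans ((le_maxmin_objectiveP _ r_gt0 _ _).1 (lexx _) j).
  by rewrite mulr_gt0.
(* The phase has the same modulus as the received value, so it is nonzero; the closed constraints
   make it a nonnegative real. *)
rewrite -cmod_eq0 -(cmod_div_unit _ (d_unit j)) cmod_eq0 lt_neqAle eq_sym => -> /=.
by rewrite lecE /= Re0 [X in X == _]Im0 eqxx.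
Qed.

End Existence.

(** The two singleton equalities record existence and uniqueness for both problems, so the last
    equality compares genuine optima and not the default value of [xget]. *)
Theorem lemma3 (R : realType) (K M : nat)
    (H : 'M[R[i]]_(K.+1, M.+1)) (d : 'I_K.+1 -> R[i])
    (r : 'I_K.+1 -> R) (P : R)
    (d_unit : forall j, cmod (d j) = 1)
    (r_gt0 : forall j, 0 < r j)
    (P_gt0 : 0 < P)
    (feasible : exists q, maxmin_feasible H d P q) :
  let tstar := maxmin_value H d r P in
  let q := maxmin_sol d H r P in
  let x := powermin_sol d H (fun j => tstar * r j) in
  [/\ maxmin_optima H d r P = [set q],
      powermin_optima H d (fun j => tstar * r j) = [set x]
    & q = x].
Proof.
have [q qopt] := maxmin_optima_exists d_unit r_gt0 feasible.
have maxminE : maxmin_optima H d r P = [set q].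
  apply/seteqP; split=> [x xopt|_ -> //].
  exact: (maxmin_optima_unique d_unit r_gt0 xopt qopt).
have powerminE := powermin_optima_maxmin d_unit r_gt0 qopt.
have xget_set1 (y : 'cV[R[i]]_M.+1) : xget 0 [set y] = y by exact: xget_unique.
by rewrite /maxmin_sol /powermin_sol maxminE powerminE !xget_set1.
Qed.
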